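(* Let $G=(V_1,E_1)$ be a connected graph with $|V_1|\ge 2$ and $H=(V_2,E_2)$ an arbitrary graph with $|V_2|\ge 1$ and adjacency matrix $A_H$. If \[ -2-\psi_{H*}^{-1}(\mathrm{QEC}(G))<\min\mathrm{ev}(A_H), \] then \[ \mathrm{QEC}(G\odot H)=\psi_{H*}^{-1}(\mathrm{QEC}(G)). \]
   Context: All graphs are finite, simple and undirected. For a connected graph $G=(V,E)$ with $|V|\ge2$ and distance matrix $D=[d(x,y)]_{x,y\in V}$ (graph distance), $\mathrm{QEC}(G)=\max\{\langle f,Df\rangle\,;\, f\in C(V),\ \langle f,f\rangle=1,\ \langle \mathbf{1},f\rangle=0\}$, where $C(V)$ is the space of real column vectors indexed by $V$ with the canonical inner product and $\mathbf{1}$ is the all-one vector. Corona: for graphs $G=(V_1,E_1)$, $H=(V_2,E_2)$ with $V_1\cap V_2=\emptyset$, $G\odot H$ is obtained from $G$ and $|V_1|$ disjoint copies of $H$ (one for each vertex of $G$) by joining each vertex of $G$ to every vertex of its copy of $H$. Functions associated with $H$: let $A_H$ be the adjacency matrix of $H$, $\mathrm{ev}(A_H)$ the set of its distinct eigenvalues, $E_\alpha$ the orthogonal projection onto the eigenspace of $\alpha$ ($E_\alpha=0$ if $\alpha\notin\mathrm{ev}(A_H)$), and $\mathrm{ev}_{\mathrm{M}}(A_H)=\{\alpha\in\mathrm{ev}(A_H)\,;\,E_\alpha\mathbf{1}\ne0\}$ the set of main eigenvalues. The function $\omega_H$ is the maximal real analytic extension of $\lambda\mapsto 1+\lambda\langle\mathbf{1},(A_H+2+\lambda)^{-1}\mathbf{1}\rangle$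 (scalars stand for multiples of $I$), i.e. \[ \omega_H(\lambda)=1+\|E_{-2}\mathbf{1}\|^2+\sum_{\alpha\in\mathrm{ev}_{\mathrm{M}}(A_H)\setminus\{-2\}}\frac{\lambda}{\alpha+2+\lambda}\|E_\alpha\mathbf{1}\|^2 \] on $\mathbb{R}\setminus\{-\alpha-2\,;\,\alpha\in\mathrm{ev}_{\mathrm{M}}(A_H)\setminus\{-2\}\}$. It has at least one real zero; $\lambda_*$ denotes its largest zero. The function $\psi_H$ is the unique real analytic function on $\mathbb{R}\setminus\{\omega_H=0\}$ with $\psi_H(\lambda)=\lambda/\omega_H(\lambda)$ (so $\psi_H(-\alpha-2)=0$ for $\alpha\in\mathrm{ev}_{\mathrm{M}}(A_H)\setminus\{-2\}$). The restriction $\psi_{H*}=\psi_H\restriction_{(\lambda_*,+\infty)}$ is a strictly increasing bijection onto $\mathbb{R}$, and $\psi_{H*}^{-1}:\mathbb{R}\to(\lambda_*,+\infty)$ is its inverse. *)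

(* Defs.v *)
From mathcomp Require Import all_boot all_order all_algebra.
From mathcomp Require Import all_classical all_reals.

Set Implicit Arguments.
Unset Strict Implicit.
Unset Printing Implicit Defensive.

Import Order.TTheory GRing.Theory Num.Theory.

Local Open Scope classical_set_scope.
Local Open Scope ring_scope.

(* Junk value 0 when [S] has no greatest (resp. least) element; contrary
   to [sup] and [inf], a proper value is always attained. *)
Definition maximum (R : realType) (S : set R) : R := xget 0 (S `&` ubound S).
Definition minimum (R : realType) (S : set R) : R := xget 0 (S `&` lbound S).

(* A simple graph with vertex set [V] is a symmetric irreflexive [e : rel V]. *)
Section Graphs.

Definition connected_graph (V : finType) (e : rel V) : Prop :=
  forall x y : V, connect e x y.

(* Least length of a walk from [x] to [y]. If [y] is reachable from [x], it is
   so by a walk of length less than [#|V|]; otherwise the value is [#|V|]. *)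
Definition gdist (V : finType) (e : rel V) (x y : V) : nat :=
  find (fun n => [exists p : n.-tuple V, path e x p && (last x p == y)])
       (iota 0 #|V|).

(* The vertex [inr (x, u)] is the vertex [u] of the copy of H attached to [x]. *)
Definition corona (V1 V2 : finType) (G : rel V1) (H : rel V2) :
    rel (V1 + V1 * V2)%type :=
  fun a b =>
    match a, b with
    | inl x, inl y => G x y
    | inl x, inr (y, _) => x == y
    | inr (x, _), inl y => x == y
    | inr (x, u), inr (y, v) => (x == y) && H u v
    end.

End Graphs.

(* C(V) is ['cV[R]_#|V|], a vertex being identified with its rank in [enum V]. *)
Section GraphMatrices.
Variables (R : realType) (V : finType) (e : rel V).

Definition adjmx : 'M[R]_#|V| :=
  \matrix_(i, j) (e (enum_val i) (enum_val j))%:R.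

Definition distmx : 'M[R]_#|V| :=
  \matrix_(i, j) (gdist e (enum_val i) (enum_val j))%:R.

End GraphMatrices.

Definition dotc (R : realType) (n : nat) (u v : 'cV[R]_n) : R :=
  (u^T *m v) 0 0.

Definition onec (R : realType) (n : nat) : 'cV[R]_n := const_mx 1.
Arguments onec {R n}.

Definition QEC (R : realType) (V : finType) (e : rel V) : R :=
  maximum [set dotc f (distmx R e *m f) |
           f in [set f : 'cV[R]_#|V| | dotc f f = 1 /\ dotc onec f = 0]].

(* Throughout, [A] is intended to be symmetric, so that its left eigenvectors,
   which are those of [eigenvalue] and [eigenspace], are the transposes of its
   right eigenvectors. *)
Section Spectral.
Variables (R : realType) (n : nat) (A : 'M[R]_n).

Definition ev : set R := [set a | eigenvalue A a].

(* [kermx U^T] is the orthogonal complement of the row space of [U]; [proj_mx]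
   acts on row vectors from the right, hence the transposition. *)
Definition eigproj (a : R) : 'M[R]_n :=
  let U := eigenspace A a in (proj_mx U (kermx U^T))^T.

Definition ev_main : set R := [set a | ev a /\ eigproj a *m onec != 0].

Definition eigweight (a : R) : R :=
  dotc (eigproj a *m onec) (eigproj a *m onec).

Definition omega_poles : set R := [set - a - 2 | a in ev_main `\ (- 2)].

(* Meaningful outside [omega_poles] only. *)
Definition omega (l : R) : R :=
  1 + eigweight (- 2)
  + \sum_(a \in ev_main `\ (- 2)) l / (a + 2 + l) * eigweight a.

Definition omega_zeros : set R := [set l | ~ omega_poles l /\ omega l = 0].

Definition lambda_star : R := maximum omega_zeros.

(* Meaningful outside [omega_zeros] only. A pole of [omega] is a nonzero real
   number, so the analytic extension of [l / omega l] vanishes there. *)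
Definition psi (l : R) : R :=
  if `[< omega_poles l >] then 0 else l / omega l.

Definition psi_star_inv : R -> R :=
  'pinv_(fun=> 0) `]lambda_star, +oo[ psi.

End Spectral.

(* Main.v *)
Require Import Defs.
From mathcomp Require Import all_boot all_order all_algebra.
From mathcomp Require Import all_classical all_reals.
From mathcomp Require Import topology normedtype derive realfun.
From mathcomp Require Import complex ring.

(* Let A be the adjacency matrix of H, l = psi_star_inv (QEC G) and
   M = A + 2 + l, which is positive definite by hypothesis. For f on the corona
   with sum 0, let g be its restriction to G, h_x its restriction to the copy of
   H attached to x, and s x = g x + <1, h_x>. The distances in the corona give
     <f, D f> - l <f, f>
       = <s, D_G s> - sum_x (l (s x - <1, h_x>)^2 + <h_x, M h_x>).
   Since omega l = 1 + l <1, M^-1 1> is positive, the minimum over h_x of the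
   x-th summand is (l / omega l) (s x)^2 = QEC(G) (s x)^2, attained at a multiple
   of M^-1 1. So the right-hand side is at most <s, D_G s> - QEC(G) <s, s> <= 0,
   with equality for a suitable f.

   The definition of psi_star_inv returns 0 outside the range of psi. If QEC(G)
   were outside, the hypothesis would say that every eigenvalue exceeds -2, and
   then psi is onto by the intermediate value theorem: a contradiction. So the
   value of psi at l is QEC(G), without a study of psi in general. *)

Set Implicit Arguments.
Unset Strict Implicit.
Unset Printing Implicit Defensive.

Import Order.TTheory GRing.Theory Num.Theory.
Import numFieldNormedType.Exports.

Local Open Scope ring_scope.

(** * Spectral decomposition of a real symmetric matrix *)

Section QuadraticForms.
Variable R : realType.

Lemma dotcE n (u v : 'cV[R]_n) : dotc u v = \sum_i u i 0 * v i 0.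
Proof. by rewrite /dotc mxE; apply: eq_bigr => i _; rewrite mxE. Qed.

Lemma dotcC n (u v : 'cV[R]_n) : dotc u v = dotc v u.
Proof. by rewrite !dotcE; apply: eq_bigr => i _; rewrite mulrC. Qed.

Lemma dotcDr n (u v w : 'cV[R]_n) : dotc u (v + w) = dotc u v + dotc u w.
Proof. by rewrite /dotc mulmxDr mxE. Qed.

Lemma dotcZr n (u v : 'cV[R]_n) a : dotc u (a *: v) = a * dotc u v.
Proof. by rewrite /dotc -scalemxAr mxE. Qed.

Lemma dotcDl n (u v w : 'cV[R]_n) : dotc (v + w) u = dotc v u + dotc w u.
Proof. by rewrite dotcC dotcDr !(dotcC u). Qed.

Lemma dotcZl n (u v : 'cV[R]_n) a : dotc (a *: v) u = a * dotc v u.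
Proof. by rewrite dotcC dotcZr dotcC. Qed.

Lemma dotc0r n (u : 'cV[R]_n) : dotc u 0 = 0.
Proof. by rewrite /dotc mulmx0 mxE. Qed.

Lemma dotc0l n (u : 'cV[R]_n) : dotc 0 u = 0.
Proof. by rewrite dotcC dotc0r. Qed.

Lemma dotc_sumr n (I : Type) (r : seq I) (u : 'cV[R]_n) (v : I -> 'cV_n) :
  dotc u (\sum_(i <- r) v i) = \sum_(i <- r) dotc u (v i).
Proof.
elim/big_rec2: _ => [|i y1 y2 _ <-]; first exact: dotc0r.
by rewrite dotcDr.
Qed.

Lemma dotc_ge0 n (u : 'cV[R]_n) : 0 <= dotc u u.
Proof. by rewrite dotcE; apply: sumr_ge0 => i _; rewrite -expr2 sqr_ge0. Qed.

Lemma dotc_eq0 n (u : 'cV[R]_n) : (dotc u u == 0) = (u == 0).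
Proof.
apply/idP/eqP => [|->]; last by rewrite dotc0r.
rewrite dotcE psumr_eq0 => [/allP u0|i _]; last by rewrite -expr2 sqr_ge0.
apply/matrixP => i j; rewrite ord1 mxE.
by have := u0 i (mem_index_enum i); rewrite /= -expr2 sqrf_eq0 => /eqP.
Qed.

Lemma dotc_sym n (A : 'M[R]_n) (u v : 'cV_n) :
  A^T = A -> dotc (A *m u) v = dotc u (A *m v).
Proof. by move=> As; rewrite /dotc trmx_mul As mulmxA. Qed.

End QuadraticForms.

Section Spectral.
Variables (R : realType) (n : nat) (A : 'M[R]_n).
Hypothesis A_sym : A^T = A.

(** Over the complex numbers the matrix is Hermitian, hence unitarily diagonalizable with real
    spectrum. Its minimal polynomial therefore divides a product of distinct linear factors with
    real roots, and this divisibility descends to [R]. *)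
Lemma sym_diagonalizable :
  exists2 rs, uniq rs & (\sum_(r <- rs) eigenspace A r :=: 1%:M)%MS.
Proof.
case: n A A_sym => [|m] B B_sym.
  by exists [::] => //; rewrite big_nil [1%:M]thinmx0.
apply/diagonalizablePeigen/diagonalizableP.
pose f := real_complex R; pose C := map_mx f B.
have C_herm : C \is hermsymmx.
  apply: realsym_hermsym.
    by apply/is_hermitianmxP; rewrite expr0 scale1r map_mx_id // map_trmx B_sym.
  by apply/mxOverP => i j; rewrite mxE complex_real.
have /hermitian_normalmx/orthomx_spectralP C_eq := C_herm.
have d_real := hermitian_spectral_diag_real C_herm.
set P := spectralmx C in C_eq; set d := spectral_diag C in C_eq d_real.
pose u := undup [seq complex.Re (d 0 i) | i <- enum 'I_m.+1].
exists u; first exact: undup_uniq.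
rewrite -(dvdp_map (real_complex R)) -mxminpoly_map -/f -/C C_eq.
have <- : conjmx (invmx P) (diag_mx d) = invmx P *m diag_mx d *m P.
  by rewrite conjVmx // spectral_unit.
rewrite mxminpoly_uconj ?unitmx_inv ?spectral_unit// mxminpoly_diag.
have d_re i : d 0 i = f (complex.Re (d 0 i)).
  by rewrite /f /= RRe_real //; apply: (mxOverP d_real).
rewrite rmorph_prod /= /u.
have -> : [seq d 0 i | i <- enum 'I_m.+1] =
          map f [seq complex.Re (d 0 i) | i <- enum 'I_m.+1].
  by rewrite (eq_map d_re) (map_comp f).
rewrite undup_map_inj; last exact: fmorph_inj.
rewrite big_map; under [X in _ %| X]eq_bigr do rewrite map_polyXsubC.
exact: dvdpp.
Qed.


Lemma eigenspace_colP a (u : 'cV[R]_n) :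
  (u^T <= eigenspace A a)%MS <-> A *m u = a *: u.
Proof.
split=> [/eigenspaceP|] Au; last apply/eigenspaceP.
  by apply: trmx_inj; rewrite trmx_mul A_sym Au linearZ.
by rewrite -[in LHS]A_sym -trmx_mul Au linearZ.
Qed.

Lemma dotc_eigen_ortho a b (u v : 'cV[R]_n) :
  A *m u = a *: u -> A *m v = b *: v -> a != b -> dotc u v = 0.
Proof.
move=> Au Av /negPf ab; apply/eqP.
have /eqP : a * dotc u v = b * dotc u v.
  by rewrite -dotcZl -Au dotc_sym // Av dotcZr.
by rewrite -subr_eq0 -mulrBl mulf_eq0 subr_eq0 ab.
Qed.

(** A vector in both spaces is orthogonal to itself, hence zero. This is the directness that the
    computation rules of [proj_mx] require. *)
Lemma eigenspace_ortho_cap a :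
  (eigenspace A a :&: kermx (eigenspace A a)^T = 0)%MS.
Proof.
apply/eqP/rowV0P => w; rewrite sub_capmx => /andP[/submxP[c wE] /sub_kermxP w0].
apply: trmx_inj; apply/eqP; rewrite trmx0 -dotc_eq0 /dotc trmxK.
by rewrite [in X in _ *m X]wE trmx_mul mulmxA w0 mul0mx mxE.
Qed.

Lemma eigproj_eigen a (v : 'cV[R]_n) :
  A *m (eigproj A a *m v) = a *: (eigproj A a *m v).
Proof.
by apply/eigenspace_colP; rewrite trmx_mul /eigproj trmxK proj_mx_sub.
Qed.

Lemma eigproj_id a (u : 'cV[R]_n) : A *m u = a *: u -> eigproj A a *m u = u.
Proof.
move=> /eigenspace_colP Au; apply: trmx_inj.
by rewrite trmx_mul /eigproj trmxK proj_mx_id // eigenspace_ortho_cap.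
Qed.

(** Eigenvectors for [b] are orthogonal to the eigenspace of [a], so they lie in the complement that
    the projection annihilates. *)
Lemma eigproj_0 a b (u : 'cV[R]_n) :
  A *m u = b *: u -> a != b -> eigproj A a *m u = 0.
Proof.
move=> Au ab; apply: trmx_inj.
rewrite trmx_mul /eigproj trmxK proj_mx_0 ?trmx0 ?eigenspace_ortho_cap //.
apply/sub_kermxP; apply: trmx_inj; rewrite trmx_mul !trmxK trmx0.
have UA : eigenspace A a *m A = a *: eigenspace A a by exact/eigenspaceP.
apply/eqP; move: ab; rewrite -subr_eq0 => /negPf ab.
have /eqP : a *: (eigenspace A a *m u) = b *: (eigenspace A a *m u).
  by rewrite scalemxAl -UA -mulmxA Au scalemxAr.
by rewrite -subr_eq0 -scalerBl scaler_eq0 ab.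
Qed.

Lemma eigproj_not_ev a (v : 'cV[R]_n) : ~ ev A a -> eigproj A a *m v = 0.
Proof.
move=> nev; apply/eqP/negPn/negP => v0; apply: nev; apply/eigenvalueP.
exists (eigproj A a *m v)^T; first exact/eigenspaceP/eigenspace_colP/eigproj_eigen.
by rewrite trmx_eq0.
Qed.

Lemma eigproj_decomp :
  exists rs : seq R, [/\ uniq rs, forall a, ev A a <-> a \in rs &
    forall v : 'cV[R]_n, v = \sum_(a <- rs) eigproj A a *m v].
Proof.
have [rs rs_uniq rsP] := sym_diagonalizable.
have decomp (v : 'cV[R]_n) : v = \sum_(a <- rs) eigproj A a *m v.
  have : (v^T <= \sum_(r <- rs) eigenspace A r)%MS by rewrite rsP submx1.
  rewrite (big_nth 0) big_mkord => /sub_sumsmxP[w wE].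
  have vE : v = \sum_(i < size rs) (w i *m eigenspace A rs`_i)^T.
    by apply: trmx_inj; rewrite wE linear_sum /=; apply: eq_bigr => i _;
      rewrite trmxK.
  have eig i : A *m (w i *m eigenspace A rs`_i)^T =
               rs`_i *: (w i *m eigenspace A rs`_i)^T.
    by apply/eigenspace_colP; rewrite trmxK submxMl.
  rewrite (big_nth 0) big_mkord {1}vE; apply: eq_bigr => i _.
  rewrite [in RHS]vE mulmx_sumr (bigD1 i) //= eigproj_id ?eig // big1 ?addr0 //.
  move=> j ji; rewrite (eigproj_0 (eig j)) //.
  by rewrite nth_uniq // eq_sym.
exists [seq a <- rs | `[< ev A a >]]; split.
- exact: filter_uniq.
- move=> a; rewrite mem_filter; split=> [ev_a|/andP[/asboolP]] //.
  apply/andP; split; first exact/asboolP.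
  apply/negPn/negP => a_rs; have /eigenvalueP[v /eigenspaceP] := ev_a.
  rewrite -[v]trmxK => /eigenspace_colP Av; apply/negP/negPn.
  rewrite trmxK -trmx_eq0 [v^T]decomp big_seq big1 // => b b_rs.
  by rewrite (eigproj_0 Av) //; apply: contraNneq a_rs => <-.
- move=> v; rewrite [LHS]decomp big_filter [RHS]big_mkcond.
  by apply: eq_bigr => a _; case: asboolP => // /eigproj_not_ev ->.
Qed.

(** Expanding the left factor along the eigenspaces, all cross terms vanish by orthogonality. *)
Lemma dotc_eigproj (rs : seq R) a (v : 'cV[R]_n) :
    uniq rs -> (forall v : 'cV[R]_n, v = \sum_(b <- rs) eigproj A b *m v) ->
    a \in rs ->
  dotc v (eigproj A a *m v) = dotc (eigproj A a *m v) (eigproj A a *m v).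
Proof.
move=> rs_uniq rsE ars.
rewrite {1}[v]rsE dotcC dotc_sumr (bigD1_seq a) //= big1 ?addr0 // => b ba.
apply: (dotc_eigen_ortho (eigproj_eigen a v) (eigproj_eigen b v)).
by rewrite eq_sym.
Qed.

End Spectral.

(** * Zeros and sign of [omega] right of its largest pole *)

Lemma seq_min (R : realType) (s : seq R) : s != [::] ->
  exists2 m, m \in s & forall a, a \in s -> m <= a.
Proof.
elim: s => // a [|b r] IHr _.
  by exists a => [|c]; rewrite mem_seq1 // => /eqP ->.
have [//|a0 ra0 a0_min] := IHr.
have [a0a|aa0] := leP a0 a.
  by exists a0 => [|c]; rewrite in_cons ?ra0 ?orbT // => /orP[/eqP ->|/a0_min].
exists a => [|c]; first exact: mem_head.
by rewrite in_cons => /orP[/eqP -> //|/a0_min]; apply: le_trans (ltW aa0).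
Qed.

Section RationalFunction.
Variables (R : realType) (s : seq R) (w : R -> R) (W : R).

(** The shape of [omega], with [s] the main eigenvalues other than -2, [w] their weights, and [W]
    the constant part. Its analysis relies only on positivity of the weights and of the
    denominators. *)
Definition rat_om (l : R) : R := W + \sum_(a <- s) l / (a + 2 + l) * w a.

Lemma rat_om_continuous (t : R) :
  (forall a, a \in s -> 0 < a + 2 + t) -> {for t, continuous rat_om}.
Proof.
rewrite /rat_om => st; apply: cvgD; first exact: cvg_cst.
elim: s st => [|a r IHr] st.
  by under eq_fun do rewrite big_nil; rewrite big_nil; apply: cvg_cst.
under eq_fun do rewrite big_cons; rewrite big_cons; apply: cvgD; last first.
  by apply: IHr => b br; apply: st; rewrite in_cons br orbT.
apply: cvgM; last exact: cvg_cst.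
apply: cvgM; first exact: cvg_id.
apply: cvgV; first by rewrite gt_eqF // st // mem_head.
by apply: cvgD; [apply: cvg_cst|apply: cvg_id].
Qed.

Lemma rat_om_within (x y : R) :
  (forall a, a \in s -> 0 < a + 2 + x) ->
  {within `[x, y], continuous rat_om}%classic.
Proof.
move=> sx; apply: continuous_in_subspaceT => t.
rewrite inE /= in_itv /= => /andP[xt _]; apply: rat_om_continuous => a /sx.
by move=> ax; rewrite (lt_le_trans ax) // lerD2l.
Qed.

Hypothesis W_gt0 : 0 < W.
Hypothesis w_gt0 : forall a, a \in s -> 0 < w a.

Lemma rat_om_nneg l : (forall a, a \in s -> 0 < a + 2 + l) -> 0 <= l ->
  0 < rat_om l.
Proof.
move=> sl l0; rewrite /rat_om ltr_wpDr // big_seq sumr_ge0 // => a sa.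
by rewrite mulr_ge0 ?divr_ge0 // ltW ?w_gt0 ?sl.
Qed.

Lemma rat_om0 : rat_om 0 = W.
Proof.
by rewrite /rat_om big1 ?addr0 // => a _; rewrite mul0r mul0r.
Qed.

(** The value at 0 is [W], which is positive, so a nonpositive value at some [l < 0] would force a
    zero between [l] and 0. *)
Lemma rat_om_gt0 l : (forall a, a \in s -> 0 < a + 2 + l) ->
  (forall x, l <= x -> rat_om x != 0) -> 0 < rat_om l.
Proof.
move=> sl nz; have [l0|l0] := leP 0 l; first exact: rat_om_nneg.
rewrite ltNge; apply/negP => oml.
have [||x] := @IVT R rat_om l 0 0 (ltW l0); first exact: rat_om_within.
  by rewrite rat_om0 ge_min oml le_max (ltW W_gt0) orbT.
by rewrite in_itv /= => /andP[/nz/eqP].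
Qed.

Hypothesis s_gt : forall a, a \in s -> 0 < a + 2.

(** Each quotient equals [1 - (a + 2) / (a + 2 + x)], which increases with [x] because [a + 2] is
    positive. *)
Lemma rat_om_homo x y : s != [::] -> (forall a, a \in s -> 0 < a + 2 + x) ->
  x < y -> rat_om x < rat_om y.
Proof.
move=> s0 sx xy; rewrite ltrD2l.
have lt_term a : a \in s -> x / (a + 2 + x) * w a < y / (a + 2 + y) * w a.
  move=> sa; rewrite ltr_pM2r ?w_gt0 //.
  have ax := sx _ sa; have ay : 0 < a + 2 + y by rewrite (lt_trans ax) // ltrD2l.
  rewrite ltr_pdivrMr // mulrAC ltr_pdivlMr // -subr_gt0.
  have -> : y * (a + 2 + x) - x * (a + 2 + y) = (a + 2) * (y - x) by ring.
  by rewrite mulr_gt0 ?subr_gt0 ?s_gt.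
rewrite big_seq [ltRHS]big_seq; apply: ltr_sum => // .
by case: s s0 => // a r _ /=; rewrite mem_head.
Qed.

Lemma rat_om_root : s != [::] ->
  exists z, [/\ z < 0, rat_om z = 0 & forall a, a \in s -> 0 < a + 2 + z].
Proof.
move=> s0; have [a0 sa0 a0_min] := seq_min s0.
have a02 := s_gt sa0; have w0 := w_gt0 sa0; have wW := addr_gt0 w0 W_gt0.
(* At this point the term of the least element [a0] is exactly [- W]. It cancels the constant, and
   the other terms are nonpositive since [x < 0]. *)
pose x := - (a0 + 2) * W / (w a0 + W).
have x0 : x < 0 by rewrite /x mulNr mulNr oppr_lt0 divr_gt0 ?mulr_gt0.
have a0xE : a0 + 2 + x = (a0 + 2) * w a0 / (w a0 + W).
  by rewrite /x; field; rewrite gt_eqF.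
have a0x : 0 < a0 + 2 + x by rewrite a0xE divr_gt0 ?mulr_gt0.
have sx a : a \in s -> 0 < a + 2 + x.
  by move=> /a0_min aa0; rewrite (lt_le_trans a0x) // !lerD2r.
have omx : rat_om x <= 0.
  rewrite /rat_om (big_rem a0) //= a0xE /x.
  have -> : - (a0 + 2) * W / (w a0 + W) / ((a0 + 2) * w a0 / (w a0 + W)) * w a0 = - W.
    by field; rewrite !gt_eqF.
  rewrite -/x addrA subrr add0r big_seq sumr_le0 // => a /mem_rem sa.
  rewrite mulr_le0_ge0 ?(ltW (w_gt0 sa)) //.
  by rewrite mulr_le0_ge0 ?(ltW x0) // invr_ge0 ltW ?sx.
have [||z] := @IVT R rat_om x 0 0 (ltW x0); first exact: rat_om_within.
  by rewrite rat_om0 ge_min omx le_max (ltW W_gt0) orbT.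
rewrite in_itv /= => /andP[xz z0] omz; exists z; split => //.
  rewrite lt_neqAle z0 andbT; apply/eqP => zE; move/eqP: omz.
  by rewrite zE rat_om0 gt_eqF.
by move=> a /sx ax; rewrite (lt_le_trans ax) // lerD2l.
Qed.

(** The quotient blows up at [z], so the intermediate value theorem is applied to [l - q * rat_om l]
    instead, which is continuous up to [z] and negative there. *)
Lemma rat_om_surj z q : s != [::] -> rat_om z = 0 -> z < 0 ->
  (forall a, a \in s -> 0 < a + 2 + z) -> exists2 l, z < l & l / rat_om l = q.
Proof.
move=> s0 omz z0 sz.
pose k l := l - q * rat_om l.
have kz : k z = z by rewrite /k omz mulr0 subr0.
have [b zb kb] : exists2 b, z <= b & 0 <= k b.
  have [q0|q0] := leP q 0.
    exists 0; first exact: ltW.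
    by rewrite /k rat_om0 sub0r -mulNr mulr_ge0 ?oppr_ge0 // ltW.
  (* At nonnegative arguments every quotient in [rat_om] is at most 1, so [rat_om B] is at most the
     factor of [q] here. *)
  pose B := q * (W + \sum_(a <- s) w a).
  have B0 : 0 <= B.
    rewrite mulr_ge0 ?(ltW q0) // addr_ge0 ?(ltW W_gt0) // big_seq sumr_ge0 // => a sa.
    by rewrite ltW ?w_gt0.
  exists B; first by rewrite (le_trans (ltW z0)).
  rewrite /k subr_ge0 ler_pM2l // lerD2l big_seq [leRHS]big_seq ler_sum // => a sa.
  rewrite ler_piMl ?(ltW (w_gt0 sa)) // ler_pdivrMr ?mul1r; last first.
    by rewrite ltr_wpDr ?s_gt.
  by rewrite lerDr ltW ?s_gt.
have ck : {within `[z, b], continuous k}%classic.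
  apply: continuous_in_subspaceT => t.
  rewrite inE /= in_itv /= => /andP[zt _]; apply: cvgB; first exact: cvg_id.
  apply: cvgM; first exact: cvg_cst.
  apply: rat_om_continuous => a /sz az.
  by rewrite (lt_le_trans az) // lerD2l.
have [|l] := @IVT R k z b 0 zb ck.
  by rewrite kz ge_min (ltW z0) le_max kb orbT.
rewrite in_itv /= => /andP[zl lb] kl.
have {}zl : z < l.
  rewrite lt_neqAle zl andbT; apply/eqP => zE; move/eqP: kl.
  by rewrite -zE kz lt_eqF.
have oml : rat_om l != 0 by rewrite gt_eqF // -omz rat_om_homo.
exists l => //; apply/eqP; rewrite -subr_eq0.
have -> : l / rat_om l - q = k l / rat_om l by rewrite /k; field.
by rewrite kl mul0r.
Qed.

End RationalFunction.

(** * Distances in the corona *)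

Section Distance.
Variables (V : finType) (e : rel V).

(** Walks of length at least [#|V|] are covered as well, since [find] never exceeds the length of
    the list it searches. *)
Lemma gdist_le_walk x p : path e x p -> (gdist e x (last x p) <= size p)%N.
Proof.
move=> e_p; rewrite leqNgt; apply/negP => lt_p.
have p_lt : (size p < #|V|)%N.
  by rewrite -(size_iota 0 #|V|) (leq_trans lt_p) // find_size.
have := before_find 0%N lt_p; rewrite nth_iota // add0n.
by move=> /negbT/existsPn/(_ (in_tuple p)); rewrite /= e_p eqxx.
Qed.

(** A connecting walk can be shortened to one without repeated vertices, whose length is less than
    [#|V|], so the search succeeds. *)
Lemma gdist_walk x y : connect e x y ->
  exists p, [/\ path e x p, last x p = y & size p = gdist e x y].
Proof.
move=> /connectP[p e_p ->]; case: (shortenP e_p) => q e_q uniq_q _.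
set z := last x q.
pose P n := [exists r : n.-tuple V, path e x r && (last x r == z)].
have hasP : has P (iota 0 #|V|).
  apply/hasP; exists (size q); last first.
    by apply/existsP; exists (in_tuple q); rewrite e_q eqxx.
  rewrite mem_iota add0n /=.
  by have := max_card (mem (x :: q)); rewrite (card_uniqP uniq_q).
have := nth_find 0%N hasP; rewrite nth_iota;
  last by rewrite has_find size_iota in hasP.
rewrite add0n => /existsP[r /andP[e_r /eqP last_r]].
by exists r; split => //; apply: size_tuple.
Qed.

(* [phi] is pinned down from below because it drops by at most one along each
   edge, and from above because some edge makes it drop by one. *)
Lemma gdist_unique (phi : V -> V -> nat) :
    (forall x, phi x x = 0%N) ->
    (forall x y, phi x y = 0%N -> x = y) ->
    (forall x y z, e x y -> (phi x z <= (phi y z).+1)%N) ->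
    (forall x z n, phi x z = n.+1 -> exists2 y, e x y & phi y z = n) ->
  forall x y, gdist e x y = phi x y.
Proof.
move=> phi0 phi_eq phi_lip phi_desc x y.
have lower p a : path e a p -> (phi a (last a p) <= size p)%N.
  elim: p a => [|b p IHp] a /=; first by rewrite phi0.
  by move=> /andP[ab /IHp]; rewrite -ltnS; apply: leq_trans; apply: phi_lip.
have upper n : forall a, phi a y = n ->
    exists p, [/\ path e a p, last a p = y & size p = n].
  elim: n => [|n IHn] a an; first by exists [::]; split => //; apply: phi_eq.
  have [b ab /IHn[p [e_p last_p size_p]]] := phi_desc _ _ _ an.
  by exists (b :: p); rewrite /= ab e_p last_p size_p.
have [p [e_p last_p size_p]] := upper _ x erefl.
apply/eqP; rewrite eqn_leq -{1}size_p -{1}last_p gdist_le_walk //=.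
have [|q [e_q last_q <-]] := @gdist_walk x y.
  by apply/connectP; exists p.
by rewrite -{1}last_q lower.
Qed.

Lemma gdist0 x : gdist e x x = 0%N.
Proof. by apply/eqP; rewrite -leqn0; have := @gdist_le_walk x [::] isT. Qed.

Hypothesis e_conn : connected_graph e.

Lemma gdist_eq0 x y : gdist e x y = 0%N -> x = y.
Proof.
by have [[|a p] [_ <- //=]] := gdist_walk (e_conn x y); move=> <-.
Qed.

Lemma gdist_lip x y z : e x y -> (gdist e x z <= (gdist e y z).+1)%N.
Proof.
move=> xy; have [p [e_p <- <-]] := gdist_walk (e_conn y z).
by apply: (@gdist_le_walk x (y :: p)); rewrite /= xy.
Qed.

Lemma gdist_desc x z n : gdist e x z = n.+1 -> exists2 y, e x y & gdist e y z = n.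
Proof.
move=> xz; have [[|y p] [/=]] := gdist_walk (e_conn x z); first by rewrite xz.
move=> /andP[xy e_p] last_p; rewrite xz => -[size_p]; exists y => //.
apply/eqP; rewrite eqn_leq -{1}size_p -{1}last_p gdist_le_walk //=.
by rewrite -ltnS -xz gdist_lip.
Qed.

End Distance.

Section CoronaDistance.
Variables (V1 V2 : finType) (G : rel V1) (H : rel V2).
Hypotheses (G_conn : connected_graph G) (H_irr : irreflexive H).

Definition corona_dist (a b : (V1 + V1 * V2)%type) : nat :=
  match a, b with
  | inl x, inl y => gdist G x y
  | inl x, inr (y, _) => (gdist G x y).+1
  | inr (x, _), inl y => (gdist G x y).+1
  | inr (x, u), inr (y, v) =>
      if x == y then if u == v then 0%N else if H u v then 1%N else 2%N
      else (gdist G x y).+2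
  end.

(** A walk leaves a copy of [H] only through its root in [G], which costs one step for each endpoint
    in a copy. Inside a copy, the root offers a detour of length 2. *)
Lemma gdist_corona a b : gdist (corona G H) a b = corona_dist a b.
Proof.
apply: gdist_unique => {a b}.
- by case=> [x|[x u]] /=; rewrite ?gdist0 ?eqxx.
- case=> [x|[x u]] [y|[y v]] //=; first by move=> /(gdist_eq0 G_conn) ->.
  by case: eqP => // ->; case: eqP => [->|] //; case: (H u v).
- case=> [x|[x u]] [y|[y v]] [z|[z t]] //=.
  + exact: gdist_lip.
  + exact: gdist_lip.
  + by move=> /eqP ->; rewrite (leq_trans (leqnSn _)).
  + move=> /eqP ->; case: (eqVneq y z) => [->|_];
    last by rewrite (leq_trans (leqnSn _)).
    by rewrite gdist0.
  + by move=> /eqP ->.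
  + by move=> /eqP ->; case: (eqVneq y z) => // ->; case: eqP => // _; case: H.
  + by move=> /andP[/eqP ->].
  + move=> /andP[/eqP -> uv]; case: (eqVneq y z) => // _.
    case: eqP => // _; case: eqP => [<-|_]; first by rewrite uv.
    by case: (H u t); case: (H v t).
(* Descent: from a copy, step to the target if it is adjacent in the same copy, and otherwise to the
   root. From [G], follow a shortest walk of [G] and enter the copy of the target only at its
   root. *)
- case=> [x|[x u]] [z|[z t]] n /=.
  + by move=> /(gdist_desc G_conn)[y xy yz]; exists (inl y).
  + case: n => [|n] [xz].
      by exists (inr (x, t)); rewrite /= (gdist_eq0 G_conn xz) !eqxx.
    have [y xy yz] := gdist_desc G_conn xz.
    by exists (inl y) => //=; rewrite yz.
  + by move=> [xz]; exists (inl x) => /=.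
  + case: eqP => [->|_].
      case: eqP => // /eqP ut; case: ifP => [uut [<-]|_ [<-]].
        by exists (inr (z, t)); rewrite /= ?eqxx.
      by exists (inl z); rewrite /= ?eqxx ?gdist0.
    by move=> [<-]; exists (inl x) => /=.
Qed.

End CoronaDistance.

(** * QEC as a maximum that is attained *)

Section Maximum.
Local Open Scope classical_set_scope.
Variable R : realType.

Lemma maximum_eq (S : set R) m : S m -> ubound S m -> maximum S = m.
Proof.
move=> Sm mS; apply: xget_unique; first by split.
by move=> y [Sy yS]; apply/le_anti; rewrite mS ?yS.
Qed.

Lemma minimum_eq (S : set R) m : S m -> lbound S m -> minimum S = m.
Proof.
move=> Sm mS; apply: xget_unique; first by split.
by move=> y [Sy yS]; apply/le_anti; rewrite mS ?yS.
Qed.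

End Maximum.

Section CenteredSphere.
Local Open Scope classical_set_scope.
Variables (R : realType) (n : nat).

Lemma continuous_sum (T : topologicalType) (I : Type) (r : seq I)
    (f : I -> T -> R) :
  (forall i, continuous (f i)) -> continuous (fun x => \sum_(i <- r) f i x).
Proof.
move=> f_cont x; elim: r => [|i r IHr].
  by under eq_fun do rewrite big_nil; apply: cvg_cst.
under eq_fun do rewrite big_cons.
by apply: cvgD IHr; apply: f_cont.
Qed.

Definition centered_sphere : set 'rV[R]_n :=
  [set r | \sum_i r 0 i ^+ 2 = 1 /\ \sum_i r 0 i = 0].

Lemma centered_sphere_compact : compact centered_sphere.
Proof.
apply: bounded_closed_compact.
  exists 1; split; first exact: num_real.
  move=> M M1 r [r1 _] /=; rewrite (le_trans _ (ltW M1)) //.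
  rewrite [leLHS]/Num.norm /= mx_normrE; apply/bigmax_leP;
    split => // -[i j] _ /=.
  rewrite ord1 -(@expr_le1 _ 2) // -normrX ger0_norm ?sqr_ge0 // -r1.
  by rewrite (bigD1 j) //= lerDl sumr_ge0 // => k _; apply: sqr_ge0.
have -> : centered_sphere =
    (fun r : 'rV[R]_n => \sum_i r 0 i ^+ 2) @^-1` [set 1] `&`
    (fun r : 'rV[R]_n => \sum_i r 0 i) @^-1` [set 0] by [].
apply: closedI; apply: closed_comp.
- move=> r _; apply: continuous_sum => i x.
  apply: (@continuous_comp _ _ _ (fun r : 'rV[R]_n => r 0 i) (fun y => y ^+ 2)).
    exact: coord_continuous.
  exact: exprn_continuous.
- exact: closed_eq.
- by move=> r _; apply: continuous_sum => i x; apply: coord_continuous.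
- exact: closed_eq.
Qed.

Lemma centered_sphere_max (D : 'M[R]_n) : (2 <= n)%N ->
  exists2 r, centered_sphere r & forall r', centered_sphere r' ->
    dotc r'^T (D *m r'^T) <= dotc r^T (D *m r^T).
Proof.
move=> n2.
pose i0 : 'I_n := Ordinal (leq_trans (ltnSn 0) (ltnW n2)).
pose i1 : 'I_n := Ordinal n2.
have i10 : i1 != i0 by [].
have dotE (r : 'rV[R]_n) :
    dotc r^T (D *m r^T) = \sum_i \sum_j r 0 i * D i j * r 0 j.
  rewrite dotcE; apply: eq_bigr => i _; rewrite !mxE mulr_sumr.
  by apply: eq_bigr => j _; rewrite mxE mulrA.
have [|||r rS r_max] := @EVT_max_rV R n (fun r => dotc r^T (D *m r^T)) centered_sphere.
(* Nonemptiness: the vector with entries [c] and [- c] at two distinct positions has sum 0 and norm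
   1. This is where [2 <= n] matters. *)
- pose c : R := (Num.sqrt 2)^-1.
  pose r := (\row_i if i == i0 then c else if i == i1 then - c else 0) : 'rV[R]_n.
  have rE (g : R -> R) : g 0 = 0 -> \sum_i g (r 0 i) = g c + g (- c).
    move=> g0; rewrite (bigD1 i0) //= (bigD1 i1) //= big1 => [|i].
      by rewrite !mxE eqxx (negPf i10) eqxx addr0.
    by move=> /andP[/negPf i_0 /negPf i_1]; rewrite mxE i_0 i_1.
  exists r; split; last by rewrite (rE id) // subrr.
  rewrite (rE (fun t => t ^+ 2)) ?expr0n // sqrrN -mulr2n /c exprVn sqr_sqrtr //.
  by field.
- exact: centered_sphere_compact.
- apply: continuous_subspaceT; under eq_fun do rewrite dotE.
  apply: continuous_sum => i; apply: continuous_sum => j x.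
  apply: (@continuousM _ _ (fun r : 'rV[R]_n => r 0 i * D i j)
                           (fun r : 'rV[R]_n => r 0 j)).
    apply: (@continuousM _ _ (fun r : 'rV[R]_n => r 0 i) (fun=> D i j)).
      exact: coord_continuous.
    exact: cst_continuous.
  exact: coord_continuous.
by exists r => [|r' r'S]; [exact: set_mem|apply: r_max; apply: mem_set].
Qed.

End CenteredSphere.

Section QECForm.
Variables (R : realType) (V : finType).

Definition vcol (F : V -> R) : 'cV[R]_#|V| := \col_i F (enum_val i).

Lemma vcolK (v : 'cV[R]_#|V|) : vcol (fun x => v (enum_rank x) 0) = v.
Proof. by apply/colP => i; rewrite mxE enum_valK. Qed.

Lemma sum_enum_val (F : V -> R) : \sum_(i < #|V|) F (enum_val i) = \sum_x F x.
Proof.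
rewrite (reindex enum_rank) /=; last exact/onW_bij/enum_rank_bij.
by apply: eq_bigr => x _; rewrite enum_rankK.
Qed.

Lemma dotc_vcol (F F' : V -> R) : dotc (vcol F) (vcol F') = \sum_x F x * F' x.
Proof. by rewrite dotcE -sum_enum_val; apply: eq_bigr => i _; rewrite !mxE. Qed.

Lemma onec_vcol : onec = vcol (fun=> 1).
Proof. by apply/colP => i; rewrite !mxE. Qed.

Lemma dotc_onec_vcol F : dotc onec (vcol F) = \sum_x F x.
Proof. by rewrite onec_vcol dotc_vcol; apply: eq_bigr => x _; rewrite mul1r. Qed.

Lemma dotc_mulmx_vcol (d : V -> V -> R) (F : V -> R) :
  dotc (vcol F) ((\matrix_(i, j) d (enum_val i) (enum_val j)) *m vcol F) =
  \sum_x \sum_y d x y * (F x * F y).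
Proof.
rewrite dotcE -sum_enum_val; apply: eq_bigr => i _; rewrite !mxE mulr_sumr.
by rewrite -sum_enum_val; apply: eq_bigr => j _; rewrite !mxE mulrCA.
Qed.

Variable e : rel V.

Definition dist_form (F : V -> R) : R :=
  \sum_x \sum_y (gdist e x y)%:R * (F x * F y).

Lemma dotc_distmx_vcol F : dotc (vcol F) (distmx R e *m vcol F) = dist_form F.
Proof. exact: (dotc_mulmx_vcol (fun x y => (gdist e x y)%:R)). Qed.

Lemma dist_formZ c F : dist_form (fun x => c * F x) = c ^+ 2 * dist_form F.
Proof.
rewrite /dist_form mulr_sumr; apply: eq_bigr => x _; rewrite mulr_sumr.
by apply: eq_bigr => y _; ring.
Qed.

(** Both sides are homogeneous of degree 2, so the constraint of unit norm can be traded for the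
    factor [\sum_x F x ^+ 2]. *)
Lemma QEC_unique m F :
    0 < \sum_x F x ^+ 2 -> \sum_x F x = 0 -> dist_form F = m * \sum_x F x ^+ 2 ->
    (forall F', \sum_x F' x = 0 -> dist_form F' <= m * \sum_x F' x ^+ 2) ->
  QEC R e = m.
Proof.
move=> F_gt0 F0 Fm m_max; apply: maximum_eq; last first.
  move=> _ [f [f1 f0] <-]; rewrite -[f]vcolK in f1 f0 *.
  rewrite dotc_distmx_vcol; rewrite dotc_onec_vcol in f0.
  rewrite (le_trans (m_max _ f0)) //; rewrite dotc_vcol in f1.
  by under eq_bigr do rewrite expr2; rewrite f1 mulr1.
pose c := (Num.sqrt (\sum_x F x ^+ 2))^-1.
have c2 : c ^+ 2 * \sum_x F x ^+ 2 = 1.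
  by rewrite /c exprVn sqr_sqrtr ?ltW // mulVf ?gt_eqF.
exists (vcol (fun x => c * F x)); first split.
- rewrite dotc_vcol -[RHS]c2 mulr_sumr; apply: eq_bigr => x _; ring.
- by rewrite dotc_onec_vcol -mulr_sumr F0 mulr0.
- by rewrite dotc_distmx_vcol dist_formZ Fm mulrCA c2 mulr1.
Qed.

(** By compactness the maximum is genuine, so [QEC] is not the default value of [maximum]. Rescaling
    removes the norm constraint. *)
Lemma QEC_attained : (2 <= #|V|)%N ->
  (exists F, [/\ 0 < \sum_x F x ^+ 2, \sum_x F x = 0 &
     dist_form F = QEC R e * \sum_x F x ^+ 2]) /\
  (forall F, \sum_x F x = 0 -> dist_form F <= QEC R e * \sum_x F x ^+ 2).
Proof.
move=> V2; have [r [r1 r0] r_max] := centered_sphere_max (distmx R e) V2.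
pose F x := r 0 (enum_rank x); set m := dotc _ _ in r_max.
have rE : r^T = vcol F by apply/colP => i; rewrite !mxE /F enum_valK.
have sumE (g : R -> R) (F' : V -> R) : \sum_x g (F' x) = \sum_i g ((vcol F')^T 0 i).
  by rewrite -sum_enum_val; apply: eq_bigr => i _; rewrite !mxE.
have F1 : \sum_x F x ^+ 2 = 1.
  by rewrite (sumE (fun t => t ^+ 2)) -rE trmxK.
have F0 : \sum_x F x = 0 by rewrite (sumE id) -rE trmxK.
have Fm : dist_form F = m by rewrite -dotc_distmx_vcol -rE.
have m_max F' : \sum_x F' x = 0 -> dist_form F' <= m * \sum_x F' x ^+ 2.
  move=> F'0; set t := \sum_x F' x ^+ 2.
  have t_ge0 : 0 <= t by apply: sumr_ge0 => x _; apply: sqr_ge0.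
  have [t0|t0] := eqVneq t 0.
    rewrite t0 mulr0 /dist_form big1 // => x _; rewrite big1 // => y _.
    move/eqP: t0; rewrite psumr_eq0 => [/allP/(_ x (mem_index_enum x))|z _].
      by rewrite /= sqrf_eq0 => /eqP ->; rewrite mul0r mulr0.
    exact: sqr_ge0.
  have {t_ge0}t_gt0 : 0 < t by rewrite lt_def t0.
  pose c := (Num.sqrt t)^-1.
  have c2 : c ^+ 2 * t = 1 by rewrite /c exprVn sqr_sqrtr ?ltW // mulVf.
  have := r_max (vcol (fun x => c * F' x))^T; rewrite trmxK dotc_distmx_vcol.
  rewrite dist_formZ => c_max; rewrite -ler_pdivrMr //.
  have -> : t^-1 = c ^+ 2 by rewrite -[t^-1]mul1r -c2 mulfK.
  rewrite mulrC; apply: c_max; split.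
    rewrite -(sumE (fun t => t ^+ 2) (fun x => c * F' x)) -[RHS]c2 mulr_sumr.
    by apply: eq_bigr => x _; ring.
  by rewrite -(sumE id (fun x => c * F' x)) -mulr_sumr F'0 mulr0.
have -> : QEC R e = m by apply: (@QEC_unique m F); rewrite ?F1 ?mulr1.
by split=> //; exists F; rewrite F1 mulr1.
Qed.

End QECForm.

(** * The resolvent and [psi_star_inv] *)

Section Shift.
Variables (R : realType) (n : nat) (A : 'M[R]_n).
Hypothesis A_sym : A^T = A.
Variable mu : R.
Hypothesis mu_pos : forall a, ev A a -> 0 < a + mu.

Definition shift_form (v : 'cV[R]_n) : R := dotc v (A *m v + mu *: v).

Lemma dotc_shift_sym (u v : 'cV[R]_n) :
  dotc u (A *m v + mu *: v) = dotc (A *m u + mu *: u) v.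
Proof. by rewrite dotcDr dotcDl dotcZr dotcZl dotc_sym. Qed.

Lemma eigproj_shift a (v : 'cV[R]_n) :
  A *m (eigproj A a *m v) + mu *: (eigproj A a *m v) =
  (a + mu) *: (eigproj A a *m v).
Proof. by rewrite eigproj_eigen // -scalerDl. Qed.

(** Along the eigenspaces the form is the sum of the squared norms of the projections of [v],
    weighted by the positive numbers [a + mu]. *)
Lemma shift_form_gt0 v : v != 0 -> 0 < shift_form v.
Proof.
have [rs [rs_uniq rs_ev rsE]] := eigproj_decomp A_sym.
move=> v0.
have term_ge0 a : a \in rs ->
    0 <= (a + mu) * dotc (eigproj A a *m v) (eigproj A a *m v).
  by move=> /rs_ev/mu_pos/ltW a_ge0; rewrite mulr_ge0 ?dotc_ge0.
have -> : shift_form v =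
    \sum_(a <- rs) (a + mu) * dotc (eigproj A a *m v) (eigproj A a *m v).
  rewrite /shift_form {2 3}[v]rsE mulmx_sumr scaler_sumr -big_split /= dotc_sumr.
  rewrite big_seq [RHS]big_seq; apply: eq_bigr => a ars.
  by rewrite eigproj_shift dotcZr (dotc_eigproj A_sym _ rs_uniq rsE).
rewrite lt_def big_seq sumr_ge0 // andbT; apply: contra v0.
rewrite -big_seq big_seq psumr_eq0 // => /allP v_eq0;
  rewrite [v]rsE big_seq big1 // => a ars.
have := v_eq0 a ars; rewrite ars /= mulf_eq0 gt_eqF ?mu_pos ?rs_ev //=.
by rewrite dotc_eq0 => /eqP.
Qed.

Lemma shift_form_ge0 v : 0 <= shift_form v.
Proof.
have [->|/shift_form_gt0/ltW//] := eqVneq v 0.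
by rewrite /shift_form dotc0l.
Qed.

End Shift.

Section Omega.
Variables (R : realType) (n : nat) (A : 'M[R]_n).
Hypothesis A_sym : A^T = A.
Hypothesis n_gt0 : (0 < n)%N.

Lemma onec_neq0 : (onec : 'cV[R]_n) != 0.
Proof.
apply/eqP => /colP/(_ (Ordinal n_gt0)); rewrite !mxE => /eqP.
by rewrite oner_eq0.
Qed.

(** The eigenvalues form a finite list, nonempty because of [a], so [minimum] is attained and is not
    the default 0. *)
Lemma minimum_ev_le a : ev A a -> minimum (ev A) <= a.
Proof.
have [rs [_ rs_ev _]] := eigproj_decomp A_sym.
move=> ev_a; have [|m /rs_ev ev_m m_min] := @seq_min R rs.
  by apply/eqP => rs0; move/rs_ev: ev_a; rewrite rs0.
by rewrite (minimum_eq ev_m) => [|b /rs_ev /m_min]; first exact/m_min/rs_ev.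
Qed.

Section EigenvalueList.
Variable rs : seq R.
Hypotheses (rs_uniq : uniq rs) (rs_ev : forall a, ev A a <-> a \in rs).
Hypothesis rsE : forall v : 'cV[R]_n, v = \sum_(a <- rs) eigproj A a *m v.

Definition omega_seq :=
  [seq a <- rs | (a != - 2) && (eigproj A a *m onec != 0)].

Lemma omega_seqE : (ev_main A `\ (- 2) = [set` omega_seq])%classic.
Proof.
apply/seteqP; split=> [a [[ev_a a0] /eqP a2]|a]; rewrite /= mem_filter.
  by rewrite a2 a0; apply/rs_ev.
by move=> /andP[/andP[/eqP a2 a0] /rs_ev ev_a].
Qed.

Lemma omega_rat_om l :
  omega A l = rat_om omega_seq (eigweight A) (1 + eigweight A (- 2)) l.
Proof. by rewrite /omega omega_seqE -fsbig_seq // filter_uniq. Qed.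

Lemma omega_polesP l :
  omega_poles A l <-> exists2 a, a \in omega_seq & l = - a - 2.
Proof.
by rewrite /omega_poles omega_seqE; split=> [[a ? <-]|[a ? ->]]; exists a.
Qed.

Lemma omega_seq_ev a : a \in omega_seq -> ev A a.
Proof. by rewrite mem_filter => /andP[_ /rs_ev]. Qed.

Lemma eigweight_gt0 a : a \in omega_seq -> 0 < eigweight A a.
Proof.
rewrite mem_filter -andbA => /and3P[_ a0 _].
by rewrite /eigweight lt_def dotc_eq0 a0 dotc_ge0.
Qed.

(** The projections of the all-one vector add up to it, so they cannot all vanish. *)
Lemma omega_seq_neq0 : ~ ev A (- 2) -> omega_seq != [::].
Proof.
move=> n2; apply: contra onec_neq0 => /eqP s0; rewrite [X in X == _]rsE.
rewrite big_seq big1 // => a ars; apply/eqP/negPn/negP => a0.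
have : a \in omega_seq; last by rewrite s0.
rewrite mem_filter a0 ars !andbT; apply/eqP => a2; apply: n2.
by rewrite -a2; apply/rs_ev.
Qed.

Section Resolvent.
Variable l : R.
Hypothesis l_pos : forall a, ev A a -> 0 < a + (2 + l).

(** The vector [(A + 2 + l)^-1 1], written in the eigenspace decomposition. *)
Definition resolvent1 : 'cV[R]_n :=
  \sum_(a <- rs) (a + (2 + l))^-1 *: (eigproj A a *m onec).

Lemma resolvent1E : A *m resolvent1 + (2 + l) *: resolvent1 = onec.
Proof.
rewrite mulmx_sumr scaler_sumr -big_split /= [RHS]rsE.
rewrite big_seq [RHS]big_seq; apply: eq_bigr => a ars.
rewrite -scalemxAr scalerA mulrC -scalerA -scalerDr eigproj_shift // scalerA.
by rewrite mulVf ?scale1r // gt_eqF ?l_pos ?rs_ev.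
Qed.

(* The eigenvalue [-2] contributes [l / (- 2 + 2 + l) = 1] times its weight to
   the sum, which is the constant added to [1] in [omega]. *)
Lemma omega_resolvent1 : omega A l = 1 + l * dotc onec resolvent1.
Proof.
have -> : l * dotc onec resolvent1 =
          \sum_(a <- rs) l / (a + 2 + l) * eigweight A a.
  rewrite /resolvent1 dotc_sumr mulr_sumr big_seq [RHS]big_seq.
  by apply: eq_bigr => a ars;
    rewrite dotcZr (dotc_eigproj A_sym _ rs_uniq rsE) // addrA mulrA.
rewrite omega_rat_om /rat_om -addrA; congr (1 + _).
have -> : \sum_(a <- omega_seq) l / (a + 2 + l) * eigweight A a =
          \sum_(a <- rs | a != - 2) l / (a + 2 + l) * eigweight A a.
  rewrite big_filter big_mkcondr; apply: eq_bigr => a _.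
  case: eqVneq => //= a0; rewrite /eigweight a0.
  by rewrite dotc0r mulr0.
have [rs2|rs2] := boolP (- 2 \in rs).
  rewrite [RHS](bigD1_seq (- 2)) //=; congr (_ + _).
  have : 0 < - 2 + (2 + l) by apply/l_pos/rs_ev.
  by rewrite addrA addNr add0r => l0; rewrite divff ?mul1r // gt_eqF.
rewrite /eigweight eigproj_not_ev => [|//|/rs_ev]; last exact/negP.
rewrite dotc0r add0r big_seq_cond [RHS]big_seq.
apply: eq_bigl => a; rewrite andb_idr // => ars.
by apply: contraNneq rs2 => <-.
Qed.

End Resolvent.
End EigenvalueList.

End Omega.

Section PsiInverse.
Variables (R : realType) (n : nat) (A : 'M[R]_n).
Hypotheses (A_sym : A^T = A) (n_gt0 : (0 < n)%N).

Lemma pinv_default (f : R -> R) (D : set R) q :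
  ~ (f @` D)%classic q -> 'pinv_(fun=> 0) D f q = 0.
Proof. by move=> nq; rewrite /pinv_ splitV oinv_surj; case: pselect. Qed.

Lemma psi_star_inv_spec q (l := psi_star_inv A q) :
    - 2 - l < minimum (ev A) ->
  [/\ forall a, ev A a -> 0 < a + (2 + l), 0 < omega A l & l / omega A l = q].
Proof.
move=> l_lt.
have l_pos a : ev A a -> 0 < a + (2 + l).
  move=> /(minimum_ev_le A_sym) /(lt_le_trans l_lt); rewrite -subr_gt0;
    congr (0 < _).
  by ring.
have [rs [rs_uniq rs_ev rsE]] := eigproj_decomp A_sym.
set s := omega_seq A rs.
have omE := omega_rat_om rs_uniq rs_ev; rewrite -/s in omE.
have polesP := omega_polesP rs_ev; rewrite -/s in polesP.
have w_gt0 a : a \in s -> 0 < eigweight A a by apply: eigweight_gt0.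
have W_gt0 : 0 < 1 + eigweight A (- 2) by rewrite ltr_pwDl // dotc_ge0.
have s_ev a : a \in s -> ev A a by apply: omega_seq_ev.
have not_pole x : (forall a, a \in s -> 0 < a + 2 + x) -> ~ omega_poles A x.
  move=> sx /polesP[a sa xE]; have := sx _ sa.
  by rewrite xE (_ : a + 2 + (- a - 2) = 0) ?ltxx //; ring.
have psiE x : (forall a, a \in s -> 0 < a + 2 + x) -> psi A x = x / omega A x.
  by move=> /not_pole np; rewrite /psi; case: asboolP.
have sl a : a \in s -> 0 < a + 2 + l by move=> /s_ev/l_pos; rewrite addrA.
have [q_im|q_nim] := pselect ((psi A @` `]lambda_star A, +oo[) q)%classic;
  last first.
  have l0 : l = 0 by exact: pinv_default.
  have s_gt a : a \in s -> 0 < a + 2 by move=> /sl; rewrite l0 addr0.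
  have s0 : s != [::].
    apply: omega_seq_neq0 rsE _ => // /l_pos.
    by rewrite l0 addr0 addNr ltxx.
  have [z [z0 omz sz]] := rat_om_root W_gt0 w_gt0 s_gt s0.
  have lambdaE : lambda_star A = z.
    apply: maximum_eq; first by split; [exact: not_pole|rewrite omE].
    (* Right of [z] the function is strictly increasing, so [z] is its greatest zero. *)
    move=> x [_ /eqP]; rewrite omE leNgt => omx; apply/negP => zx.
    by move: omx; rewrite gt_eqF // -omz rat_om_homo.
  have [x zx xq] := rat_om_surj W_gt0 w_gt0 s_gt q s0 omz z0 sz.
  case: q_nim; exists x; first by rewrite /= lambdaE in_itv /= zx.
  rewrite psiE ?omE // => a /sz az.
  by rewrite (lt_trans az) // ltrD2l.
have psi_l : psi A l = q by apply: pinvK; apply: mem_set.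
have l_gt : lambda_star A < l.
  have /(_ l) := @surjpinv_image_sub _ _ (fun=> 0) `]lambda_star A, +oo[%classic
    (psi A @` `]lambda_star A, +oo[)%classic (psi A) (fun _ => id).
  by move=> /(_ (ex_intro2 _ _ q q_im erefl)); rewrite /= in_itv /= andbT.
split=> //; last by rewrite -psiE.
(* For negative [l], it suffices to exclude zeros of [omega] at or beyond [l]. If there is a
   greatest zero, it is [lambda_star], which is less than [l]. Otherwise [lambda_star] is the
   default 0, and [l] would be positive. *)
rewrite omE; have [l0|l0] := leP 0 l; first exact: rat_om_nneg.
apply: rat_om_gt0 => // x lx; apply/eqP => omx.
have xz : omega_zeros A x.
  split; last by rewrite omE.
  by apply: not_pole => a /sl al; rewrite (lt_le_trans al) // lerD2l.
have [[m [m_zero m_max]]|no_max] :=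
  pselect (exists m, omega_zeros A m /\ ubound (omega_zeros A) m).
  have lambdaE : lambda_star A = m by exact: maximum_eq.
  by have := m_max _ xz; rewrite leNgt (lt_le_trans _ lx) // -lambdaE.
move: l_gt; rewrite /lambda_star /maximum xgetPN => [|m [? ?]].
  by rewrite ltNge (ltW l0).
by apply: no_max; exists m.
Qed.

End PsiInverse.

(** * Minimization of the quadratic form over one copy of H *)

Section PointwiseMinimum.
Variables (R : realType) (n : nat) (A : 'M[R]_n).
Hypotheses (A_sym : A^T = A) (n_gt0 : (0 < n)%N).
Variable l : R.
Hypothesis l_pos : forall a, ev A a -> 0 < a + (2 + l).
Hypothesis om_gt0 : 0 < omega A l.

Lemma pointwise_min :
  (forall (t : R) h, l / omega A l * t ^+ 2 <=
     l * (t - dotc onec h) ^+ 2 + shift_form A (2 + l) h) /\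
  (exists u, forall t : R, l / omega A l * t ^+ 2 =
     l * (t - dotc onec (t *: u)) ^+ 2 + shift_form A (2 + l) (t *: u)).
Proof.
have [rs [rs_uniq rs_ev rsE]] := eigproj_decomp A_sym.
have uE := resolvent1E A_sym rs_ev rsE l_pos.
have omE := omega_resolvent1 A_sym rs_uniq rs_ev rsE l_pos.
set u := resolvent1 A rs l in uE omE; set c := dotc onec u in omE.
have form_u h x : shift_form A (2 + l) (h + x *: u) =
    shift_form A (2 + l) h + 2 * x * dotc onec h + x ^+ 2 * c.
  rewrite /shift_form.
  have -> : A *m (h + x *: u) + (2 + l) *: (h + x *: u) =
            (A *m h + (2 + l) *: h) + x *: onec.
    by rewrite -uE mulmxDr -scalemxAr !scalerDr !scalerA [x * _]mulrC addrACA.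
  rewrite dotcDl dotcZl !(dotcDr _ _ (x *: _)) !dotcZr (dotc_shift_sym A_sym _ u) uE.
  by rewrite ![dotc _ onec]dotcC -/c; ring.
have c_gt0 : 0 < c.
  have u0 : u != 0.
    by apply: contra (onec_neq0 R n_gt0) => /eqP u0;
      rewrite -uE u0 mulmx0 scaler0 addr0.
  by have := shift_form_gt0 A_sym l_pos u0; rewrite /shift_form uE dotcC.
have om_neq0 : omega A l != 0 by rewrite gt_eqF.
split.
  move=> t h; set b := dotc onec h; set P := shift_form _ _ h.
  (* Cauchy-Schwarz for the form: evaluate it at [h - (b / c) u], whose inner product with the
     all-one vector is 0. *)
  have P_ge : b ^+ 2 / c <= P.
    rewrite -subr_ge0; have := shift_form_ge0 A_sym l_pos (h + (- (b / c)) *: u).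
    rewrite form_u -/b -/P; congr (0 <= _); field.
    by rewrite gt_eqF.
  rewrite -subr_ge0.
  (* Completing the square in [b], with [omega A l = 1 + l * c]. *)
  apply: (@le_trans _ _ ((b * omega A l - l * c * t) ^+ 2 / (c * omega A l))).
    by rewrite divr_ge0 ?sqr_ge0 // mulr_ge0 ?ltW.
  have -> : (b * omega A l - l * c * t) ^+ 2 / (c * omega A l) =
     l * (t - b) ^+ 2 + b ^+ 2 / c - l / omega A l * t ^+ 2.
    move: om_neq0; rewrite omE => om_neq0; field.
    by rewrite om_neq0 gt_eqF.
  by rewrite lerD2r lerD2l.
(* The square above vanishes for [b = l * c * t / omega A l], and Cauchy-Schwarz is an equality for
   [h = (b / c) u]. *)
exists ((l / omega A l) *: u) => t; rewrite scalerA.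
have := form_u 0 (t * (l / omega A l)); rewrite add0r => ->.
rewrite /shift_form dotc0l dotc0r dotcZr -/c omE.
by move: om_neq0; rewrite omE => om_neq0; field.
Qed.

End PointwiseMinimum.

(** * The distance form of the corona *)

Section CoronaForm.
Variables (R : realType) (V1 V2 : finType) (G : rel V1) (H : rel V2).
Hypotheses (G_conn : connected_graph G) (H_irr : irreflexive H).

Lemma sum_corona (F : (V1 + V1 * V2)%type -> R) :
  \sum_a F a = \sum_x (F (inl x) + \sum_u F (inr (x, u))).
Proof.
rewrite big_sumType big_split /=; congr (_ + _).
by rewrite pair_bigA; apply: eq_bigr => -[].
Qed.

Variable F : (V1 + V1 * V2)%type -> R.
Let h x : 'cV[R]_#|V2| := vcol (fun u => F (inr (x, u))).
Let s x := F (inl x) + \sum_u F (inr (x, u)).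

(** Isolates the correction to [d + 2] for two vertices in copies: it is the matrix [2 + A] on each
    diagonal block, 0 elsewhere. *)
Lemma corona_dist_inr x y u v :
  (corona_dist G H (inr (x, u)) (inr (y, v)))%:R =
  (gdist G x y)%:R + 2 - (x == y)%:R * (2 * (u == v)%:R + (H u v)%:R) :> R.
Proof.
rewrite /=; case: eqP => [->|_]; last by rewrite mul0r subr0 -addn2 natrD.
rewrite gdist0; case: eqP => [->|_]; first by rewrite H_irr /=; ring.
by case: (H u v) => /=; ring.
Qed.

Lemma dotc_adjmx_vcol (f : V2 -> R) :
  dotc (vcol f) (adjmx R H *m vcol f + 2 *: vcol f) =
  \sum_u \sum_v (2 * (u == v)%:R + (H u v)%:R) * (f u * f v).
Proof.
rewrite dotcDr dotcZr addrC.
rewrite (dotc_mulmx_vcol (fun u v => (H u v)%:R)) dotc_vcol mulr_sumr -big_split /=.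
apply: eq_bigr => u _; under [RHS]eq_bigr do rewrite mulrDl.
rewrite big_split /=; congr (_ + _).
rewrite (bigD1 u) //= eqxx mulr1 big1 ?addr0 // => v vu.
by rewrite eq_sym (negPf vu) mulr0 mul0r.
Qed.

(** Collapsing each copy onto its root gives the first term. The additional step for each endpoint
    in a copy gives the second, which vanishes when [F] has sum 0. The third corrects for pairs
    inside one copy. *)
Lemma dist_form_corona :
  dist_form (corona G H) F =
  dist_form G s + 2 * (\sum_x \sum_u F (inr (x, u))) * (\sum_x s x)
  - \sum_x dotc (h x) (adjmx R H *m h x + 2 *: h x).
Proof.
pose b x := \sum_u F (inr (x, u)); pose g x := F (inl x).
pose d a c : R := (corona_dist G H a c)%:R * (F a * F c).
pose K x := dotc (h x) (adjmx R H *m h x + 2 *: h x).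
(* The contribution of all pairs with one vertex at [x] or in its copy and the other at [y] or in
   its copy. *)
have block x y : d (inl x) (inl y) + \sum_v d (inl x) (inr (y, v)) +
    \sum_u (d (inr (x, u)) (inl y) + \sum_v d (inr (x, u)) (inr (y, v))) =
    (gdist G x y)%:R * (s x * s y) + (g x * b y + b x * g y + 2 * (b x * b y))
    - (x == y)%:R * K x.
  have -> : \sum_v d (inl x) (inr (y, v)) = ((gdist G x y)%:R + 1) * (g x * b y).
    rewrite !mulr_sumr; apply: eq_bigr => v _.
    by rewrite /d /= -addn1 natrD mulrA.
  rewrite big_split /=.
  have -> : \sum_u d (inr (x, u)) (inl y) = ((gdist G x y)%:R + 1) * (b x * g y).
    rewrite mulrCA mulr_suml; apply: eq_bigr => u _.
    by rewrite /d /= -addn1 natrD mulrCA.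
  have -> : \sum_u \sum_v d (inr (x, u)) (inr (y, v)) =
      ((gdist G x y)%:R + 2) * (b x * b y) - (x == y)%:R * K x.
    rewrite /K dotc_adjmx_vcol /b big_distrlr /= !mulr_sumr -sumrB.
    apply: eq_bigr => u _; rewrite !mulr_sumr -sumrB.
    apply: eq_bigr => v _; rewrite /d corona_dist_inr.
    by case: eqP => [->|_] /=; ring.
  by rewrite /d /s -/(b x) -/(b y) -/(g x) -/(g y) /=; ring.
transitivity (\sum_x \sum_y ((gdist G x y)%:R * (s x * s y) +
    (g x * b y + b x * g y + 2 * (b x * b y)) - (x == y)%:R * K x)).
  transitivity (\sum_a \sum_c d a c).
    by apply: eq_bigr => a _; apply: eq_bigr => c _; rewrite gdist_corona.
  rewrite sum_corona; apply: eq_bigr => x _.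
  under [X in _ + X]eq_bigr do rewrite sum_corona.
  rewrite sum_corona exchange_big -big_split /=.
  by apply: eq_bigr => y _; rewrite block.
have sumE : \sum_x s x = \sum_x g x + \sum_x b x by rewrite -big_split.
have -> : 2 * (\sum_x b x) * (\sum_x s x) =
    \sum_x \sum_y (g x * b y + b x * g y + 2 * (b x * b y)).
  under [RHS]eq_bigr => x _.
    rewrite !big_split /= -!mulr_sumr; over.
  rewrite sumE !big_split /= -mulr_sumr -!mulr_suml; ring.
rewrite /dist_form -!big_split /= -sumrB; apply: eq_bigr => x _.
rewrite -big_split /= sumrB; congr (_ - _).
rewrite (bigD1 x) //= eqxx mul1r big1 ?addr0 // => y yx.
by rewrite eq_sym (negPf yx) mul0r.
Qed.

End CoronaForm.

(** * The QEC of the corona *)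

Theorem theorem4p11 (R : realType)
    (V1 : finType) (G : rel V1)
    (G_sym : symmetric G) (G_irr : irreflexive G)
    (G_conn : connected_graph G) (V1_ge2 : (2 <= #|V1|)%N)
    (V2 : finType) (H : rel V2)
    (H_sym : symmetric H) (H_irr : irreflexive H)
    (V2_ge1 : (1 <= #|V2|)%N)
    (h_lt : - 2 - psi_star_inv (adjmx R H) (QEC R G)
              < minimum (ev (adjmx R H))) :
  QEC R (corona G H) = psi_star_inv (adjmx R H) (QEC R G).
Proof.
set A := adjmx R H in h_lt *; set q := QEC R G in h_lt *.
set l := psi_star_inv A q in h_lt *.
have A_sym : A^T = A by apply/matrixP => i j; rewrite !mxE H_sym.
have [l_pos om_gt0 lq] := psi_star_inv_spec A_sym V2_ge1 h_lt.
have [h_ge [u h_eq]] := pointwise_min A_sym V2_ge1 l_pos om_gt0.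
rewrite -/l lq in h_ge h_eq l_pos om_gt0.
have [[S [S_gt0 S0 S_max]] q_max] := QEC_attained R G V1_ge2.
rewrite -/q in S_max q_max.
pose h F x : 'cV[R]_#|V2| := vcol (fun v => F (inr (x, v) : V1 + V1 * V2)%type).
pose s (F : (V1 + V1 * V2)%type -> R) x := F (inl x) + \sum_v F (inr (x, v)).
have formE F : \sum_a F a = 0 -> dist_form (corona G H) F - l * \sum_a F a ^+ 2 =
    dist_form G (s F) -
    \sum_x (l * (s F x - dotc onec (h F x)) ^+ 2 + shift_form A (2 + l) (h F x)).
  rewrite sum_corona => F0.
  rewrite dist_form_corona // F0 mulr0 addr0 -addrA -opprD; congr (_ - _).
  rewrite sum_corona mulr_sumr -big_split /=; apply: eq_bigr => x _.
  have -> : \sum_v F (inr (x, v)) ^+ 2 = dotc (h F x) (h F x).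
    by rewrite dotc_vcol; apply: eq_bigr.
  rewrite dotc_onec_vcol /s addrK /shift_form [(2 + l) *: _]scalerDl addrA.
  by rewrite [dotc _ (_ + l *: _)]dotcDr dotcZr -/(h F x); ring.
have s_sum F : \sum_a F a = \sum_x s F x by exact: sum_corona.
(* The extremal function: the optimal multiple of [u] on each copy, with the value at the root
   adjusted so that [s F0] is the maximizer [S] for [G]. *)
pose F0 a := match a with
  | inl x => S x - dotc onec (S x *: u)
  | inr (x, v) => (S x *: u) (enum_rank v) 0
  end.
have hF0 x : h F0 x = S x *: u by rewrite /h vcolK.
have sF0 x : s F0 x = S x.
  by rewrite /s -(dotc_onec_vcol (fun v => F0 (inr (x, v)))) -/(h F0 x) hF0 subrK.
have sum_F0 : \sum_a F0 a = 0.
  by rewrite s_sum; under eq_bigr do rewrite sF0.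
apply: (@QEC_unique _ _ _ l F0) => //.
(* If [F0] vanished, so would [s F0 = S]. *)
- rewrite lt_def sumr_ge0 ?andbT => [|a _]; last exact: sqr_ge0.
  apply: contraTneq S_gt0 => /eqP; rewrite psumr_eq0 => [/allP F00|a _];
    last exact: sqr_ge0.
  rewrite big1 ?ltxx // => x _; rewrite -sF0 /s.
  have F0E a : F0 a = 0.
    by have := F00 a (mem_index_enum a); rewrite /= sqrf_eq0 => /eqP.
  by rewrite F0E big1 ?addr0 ?expr0n.
- apply/eqP; rewrite -subr_eq0 formE //.
  have -> : dist_form G (s F0) = dist_form G S.
    by congr dist_form; apply/funext.
  rewrite S_max mulr_sumr -sumrB big1 // => x _.
  by rewrite sF0 hF0 -h_eq subrr.
- move=> F F_sum; rewrite -subr_le0 formE // subr_le0.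
  rewrite (le_trans (q_max (s F) _)) -?s_sum // mulr_sumr.
  by apply: ler_sum => x _; apply: h_ge.
Qed.
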